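(* If a metric space $(X,d_X)$ satisfies the $O_3$-comparison, where $O_3$ is the octahedron graph, then for any $a,b,c,s,t\in[0,1]$ with $a\leq s$ and any points $x_0,x_1,y_0,y_1,z_0,z_1\in X$, we have \begin{align*} &sta\big((1-t)(1-a)+(1-s)tb\big)\,d_X(x_0,x_1)^2 + s(1-t)t(1-b)b\,d_X(y_0,y_1)^2 + ab(1-c)c\,d_X(z_0,z_1)^2\\ &\quad\leq (1-s)tab(1-c)\,d_X(x_0,z_0)^2 + stab(1-c)\,d_X(x_1,z_0)^2 + (1-t)ab(1-c)\,d_X(y_1,z_0)^2\\ &\qquad + (1-s)tabc\,d_X(x_0,z_1)^2 + stabc\,d_X(x_1,z_1)^2 + (1-t)abc\,d_X(y_1,z_1)^2\\ &\qquad + s(1-t)t(1-a)(1-b)\,d_X(x_0,y_0)^2 + s(1-t)ta(1-b)\,d_X(x_1,y_0)^2 + (1-t)t(s-a)b\,d_X(x_0,y_1)^2. \end{align*}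
   Context: Graphs are simple and undirected. Let $G=(V,E)$ be a graph with vertex set $V$ and edge set $E$. A metric space $(X,d_X)$ is said to satisfy the $G$-comparison if for any map $f\colon V\to X$ there exists a map $g\colon V\to\mathcal{H}$ to a Hilbert space $\mathcal{H}$ such that for any $u,v\in V$: $\|g(u)-g(v)\|\leq d_X(f(u),f(v))$ if $\{u,v\}\in E$, and $\|g(u)-g(v)\|\geq d_X(f(u),f(v))$ if $\{u,v\}\notin E$. The octahedron graph $O_3$ is the graph on $6$ vertices that are partitioned into three pairs (the pairs of opposite vertices of an octahedron), in which two distinct vertices are adjacent if and only if they do not form one of these three pairs (i.e. the complete tripartite graph $K_{2,2,2}$). *)

(* Defs.v *)
From mathcomp Require Export all_boot all_order all_algebra.
From mathcomp Require Export all_classical all_reals all_analysis.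
Export Order.TTheory GRing.Theory Num.Theory.
Export numFieldNormedType.Exports.

Set Implicit Arguments.
Unset Strict Implicit.
Unset Printing Implicit Defensive.

Local Open Scope ring_scope.

Record simple_graph := SimpleGraph {
  vertex :> Type;
  adj : rel vertex;
  adj_sym : symmetric adj;
  adj_irrefl : irreflexive adj }.

(* A real Hilbert space: a complete normed space whose norm comes from an
   inner product, i.e. a symmetric positive definite bilinear form. *)
Definition is_hilbert (R : realType) (H : completeNormedModType R) : Prop :=
  exists inner : {dot H for idfun}, forall x : H, `|x| ^+ 2 = inner x x.

(* The case u = v, which falls under non-adjacency, only says 0 >= 0. *)
Definition graph_comparison (R : realType) (G : simple_graph)
    (X : metricType R) : Prop :=
  forall f : G -> X,
  exists H : completeNormedModType R, is_hilbert H /\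
  exists g : G -> H, forall u v : G,
    (adj u v -> `|g u - g v| <= mdist (f u) (f v)) /\
    (~~ adj u v -> mdist (f u) (f v) <= `|g u - g v|).

(* The octahedron graph K_{2,2,2}: the pairs of opposite vertices are
   {(i, false), (i, true)} for i < 3. *)
Definition octahedron_adj : rel ('I_3 * bool) := fun u v => u.1 != v.1.

Lemma octahedron_adj_sym : symmetric octahedron_adj.
Proof. by move=> u v; rewrite /octahedron_adj eq_sym. Qed.

Lemma octahedron_adj_irrefl : irreflexive octahedron_adj.
Proof. by move=> u; rewrite /octahedron_adj eqxx. Qed.

Definition octahedron : simple_graph :=
  SimpleGraph octahedron_adj_sym octahedron_adj_irrefl.

(* Main.v *)
(** With [p = (1-t) y1 + t ((1-s) x0 + s x1)], [z = (1-c) z0 + c z1],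
    [q = (1-a) x0 + a x1] and [r = (1-b) y0 + b y1], repeated use of Stewart's
    identity shows that in a Hilbert space the right-hand side minus the
    left-hand side equals [ab |p - z|^2 + st(1-t) |q - r|^2 >= 0]. In the
    inequality the pairs of opposite vertices occur only on the left and the
    edges only on the right, so the comparison map transfers it to [X]. *)
Require Import Defs.
From mathcomp Require Import ring.

Local Open Scope ring_scope.

(** Since the weights [1 - r] and [r] sum to 1, [w] can be translated to the origin; both sides are
    then the same quadratic expression in two vectors. *)
Lemma hilbert_stewart (R : realType) (H : completeNormedModType R)
  (hH : is_hilbert H) (r : R) (u v w : H) :
  `|(1 - r) *: u + r *: v - w| ^+ 2 =
  (1 - r) * `|u - w| ^+ 2 + r * `|v - w| ^+ 2 - r * (1 - r) * `|u - v| ^+ 2.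
Proof.
have [inner normE] := hH.
have -> : (1 - r) *: u + r *: v - w = (1 - r) *: (u - w) + r *: (v - w).
  by rewrite !scalerBr addrACA -opprD -scalerDl subrK scale1r.
have -> : u - v = (u - w) - (v - w) by rewrite opprB addrA subrK.
move: (u - w) (v - w) => {}u {}v; rewrite !normE.
(* A dot form has sign exponent 0 and the identity as conjugation, so Hermitian symmetry is plain
   symmetry. *)
have innerC : inner v u = inner u v by rewrite hermC expr0 mul1r.
have innerBB : inner (u - v) (u - v) =
    inner u u - inner u v - (inner u v - inner v v).
  by rewrite (linearBl inner) !(linearBr inner) /= innerC.
have innerZD k l : inner (k *: u + l *: v) (k *: u + l *: v) =
    k * (k * inner u u) + k * (l * inner u v)
    + (l * (k * inner u v) + l * (l * inner v v)).
  by rewrite linearDl !linearDr /= !linearZl_LR !linearZ_LR /= innerC.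
by rewrite innerBB innerZD; ring.
Qed.

Lemma hilbert_octahedron_ineq (R : realType) (H : completeNormedModType R)
  (hH : is_hilbert H) (a b c s t : R)
  (a0 : 0 <= a) (b0 : 0 <= b) (s0 : 0 <= s) (t0 : 0 <= t) (t1 : t <= 1)
  (x0 x1 y0 y1 z0 z1 : H) :
  s * t * a * ((1 - t) * (1 - a) + (1 - s) * t * b) * `|x0 - x1| ^+ 2
  + s * (1 - t) * t * (1 - b) * b * `|y0 - y1| ^+ 2
  + a * b * (1 - c) * c * `|z0 - z1| ^+ 2
  <=
  (1 - s) * t * a * b * (1 - c) * `|x0 - z0| ^+ 2
  + s * t * a * b * (1 - c) * `|x1 - z0| ^+ 2
  + (1 - t) * a * b * (1 - c) * `|y1 - z0| ^+ 2
  + (1 - s) * t * a * b * c * `|x0 - z1| ^+ 2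
  + s * t * a * b * c * `|x1 - z1| ^+ 2
  + (1 - t) * a * b * c * `|y1 - z1| ^+ 2
  + s * (1 - t) * t * (1 - a) * (1 - b) * `|x0 - y0| ^+ 2
  + s * (1 - t) * t * a * (1 - b) * `|x1 - y0| ^+ 2
  + (1 - t) * t * (s - a) * b * `|x0 - y1| ^+ 2.
Proof.
pose x := (1 - s) *: x0 + s *: x1; pose p := (1 - t) *: y1 + t *: x.
pose z := (1 - c) *: z0 + c *: z1; pose q := (1 - a) *: x0 + a *: x1.
pose r := (1 - b) *: y0 + b *: y1.
have stewart := hilbert_stewart _ _ hH.
(* The last bracket is [|y1 - x| ^+ 2], itself expanded by Stewart. *)
have pE w : `|p - w| ^+ 2 = (1 - t) * `|y1 - w| ^+ 2
    + t * ((1 - s) * `|x0 - w| ^+ 2 + s * `|x1 - w| ^+ 2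
           - s * (1 - s) * `|x0 - x1| ^+ 2)
    - t * (1 - t) * ((1 - s) * `|x0 - y1| ^+ 2 + s * `|x1 - y1| ^+ 2
                     - s * (1 - s) * `|x0 - x1| ^+ 2).
  by rewrite stewart (distrC y1 x) !stewart.
(* The weights [a * b] here and [s * t * (1 - t)] below make the [|x1 - y1|] terms cancel and leave
   [(1 - t) * t * (s - a) * b] in front of [|x0 - y1| ^+ 2]. *)
have pz_ge0 : 0 <= a * b * `|z - p| ^+ 2 by rewrite !mulr_ge0 ?exprn_ge0.
have qr_ge0 : 0 <= s * t * (1 - t) * `|q - r| ^+ 2.
  by rewrite !mulr_ge0 ?exprn_ge0 ?subr_ge0.
rewrite -subr_ge0; apply: le_trans (addr_ge0 pz_ge0 qr_ge0) _.
rewrite le_eqVlt; apply/orP; left; apply/eqP.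
rewrite stewart -!(distrC p) !pE stewart -!(distrC r) !stewart.
(* One orientation per pair of points, so that [ring] treats each distance as a single atom. *)
rewrite !(distrC y0 x0, distrC y0 x1, distrC y1 x0, distrC y1 x1).
ring.
Qed.

Theorem proposition1p8 (R : realType) (X : metricType R)
  (hX : graph_comparison octahedron X)
  (a b c s t : R)
  (ha : 0 <= a <= 1) (hb : 0 <= b <= 1) (hc : 0 <= c <= 1)
  (hs : 0 <= s <= 1) (ht : 0 <= t <= 1) (has : a <= s)
  (x0 x1 y0 y1 z0 z1 : X) :
  s * t * a * ((1 - t) * (1 - a) + (1 - s) * t * b) * mdist x0 x1 ^+ 2
  + s * (1 - t) * t * (1 - b) * b * mdist y0 y1 ^+ 2
  + a * b * (1 - c) * c * mdist z0 z1 ^+ 2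
  <=
  (1 - s) * t * a * b * (1 - c) * mdist x0 z0 ^+ 2
  + s * t * a * b * (1 - c) * mdist x1 z0 ^+ 2
  + (1 - t) * a * b * (1 - c) * mdist y1 z0 ^+ 2
  + (1 - s) * t * a * b * c * mdist x0 z1 ^+ 2
  + s * t * a * b * c * mdist x1 z1 ^+ 2
  + (1 - t) * a * b * c * mdist y1 z1 ^+ 2
  + s * (1 - t) * t * (1 - a) * (1 - b) * mdist x0 y0 ^+ 2
  + s * (1 - t) * t * a * (1 - b) * mdist x1 y0 ^+ 2
  + (1 - t) * t * (s - a) * b * mdist x0 y1 ^+ 2.
Proof.
have [/andP[a0 a1] /andP[b0 b1]] := (ha, hb).
have [/andP[c0 c1] /andP[s0 s1] /andP[t0 t1]] := And3 hc hs ht.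
(* The index selects the letter and the boolean the subscript, so opposite vertices go to [x0, x1],
   to [y0, y1] and to [z0, z1]. *)
pose f (u : octahedron) : X :=
  tnth (if u.2 then [tuple x1; y1; z1] else [tuple x0; y0; z0]) u.1.
have [H [hH [g gP]]] := hX f.
have adj_le u v : adj u v -> `|g u - g v| ^+ 2 <= mdist (f u) (f v) ^+ 2.
  by move=> uv; rewrite ler_pXn2r ?nnegrE ?mdist_ge0//; apply (gP u v).1.
have opp_le u v : ~~ adj u v -> mdist (f u) (f v) ^+ 2 <= `|g u - g v| ^+ 2.
  by move=> uv; rewrite ler_pXn2r ?nnegrE ?mdist_ge0//; apply (gP u v).2.
pose X_ e : octahedron := (0 : 'I_3, e).
pose Y_ e : octahedron := (1 : 'I_3, e).
pose Z_ e : octahedron := (2 : 'I_3, e).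
apply: le_trans (le_trans (hilbert_octahedron_ineq _ _ hH _ _ c _ _ a0 b0 s0 t0 t1
  (g (X_ false)) (g (X_ true)) (g (Y_ false)) (g (Y_ true))
  (g (Z_ false)) (g (Z_ true))) _).
  do ?apply: lerD; apply: ler_wpM2l.
  all: try by rewrite ?(subr_ge0, mulr_ge0, addr_ge0).
  - exact: (opp_le (X_ false) (X_ true)).
  - exact: (opp_le (Y_ false) (Y_ true)).
  - exact: (opp_le (Z_ false) (Z_ true)).
(* Termwise comparison requires nonnegative coefficients; for the [x0], [y1] term this is where
   [a <= s] enters. *)
do ?apply: lerD; apply: ler_wpM2l.
all: by [exact: adj_le | rewrite ?(subr_ge0, mulr_ge0, addr_ge0)].
Qed.
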